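(* Let $H$ be a graph with $n$ vertices, $m$ edges and maximum degree $\Delta(H)\le 3$. Then for every integer $q\ge 2$, $$m(q-1)+n \;\le\; f(H,q)\;\le\; 7mq+8n+14q,$$ and hence $f(H,q)=\Theta(mq+n)$ (with absolute implied constants).
   Context: Graphs are finite and simple. A $K_f$-minor (for an integer $f\ge 1$) is a graph $G$ whose vertex set is partitioned into $f$ disjoint non-empty sets $X_1,\dots,X_f$ such that for every $i$ the induced subgraph $G[X_i]$ is connected, and for all $i\ne j$ there is at least one edge of $G$ with endpoints in $X_i$ and $X_j$. A subdivision of a graph $H$ is any graph obtained from $H$ by replacing its edges with internally vertex-disjoint paths connecting the original endpoints of the edges; these paths are called subdivision paths. A subdivision of $H$ is $q$-divisible if all its subdivision paths have length (number of edges) divisible by $q$. For a graph $H$ with $\Delta(H)\le 3$ and an integer $q\ge 2$, $f(H,q)$ denotes the smallest integer $f\ge 1$ such that every $K_f$-minor contains a $q$-divisible subdivision of $H$ as a subgraph (such an integer is known to exist; this is a theorem of Alon and Krivelevich). *)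

(* Defs.v *)
From HB Require Import structures.
From mathcomp Require Import all_boot all_order all_algebra.

Set Implicit Arguments.
Unset Strict Implicit.
Unset Printing Implicit Defensive.

Record sgraph := SGraph {
  vertex :> finType;
  adj : rel vertex;
  adj_sym : symmetric adj;
  adj_irrefl : irreflexive adj
}.

Notation "x -- y" := (adj x y) (at level 30, no associativity).

Definition edges (G : sgraph) : {set {set G}} :=
  [set [set x; y] | x in G, y in G & x -- y].

Definition degree (G : sgraph) (x : G) : nat := #|[set y | x -- y]|.

Definition max_degree (G : sgraph) : nat := \max_(x : G) degree x.

(* Connectedness of the induced subgraph G[X]; true for X = set0. *)
Definition connected_in (G : sgraph) (X : {set G}) : Prop :=
  {in X &, forall x y, connect [rel u v in X | u -- v] x y}.

(* [partition] forces the blocks to be non-empty, hence the family X_1, ..., X_f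
   is the same thing as a partition with exactly f blocks. *)
Definition K_minor (f : nat) (G : sgraph) : Prop :=
  exists P : {set {set G}},
    [/\ partition P [set: G],
        #|P| = f,
        {in P, forall X : {set G}, connected_in X}
      & {in P &, forall X Y : {set G}, X != Y ->
           exists x y, [/\ x \in X, y \in Y & x -- y]}].

(* [Subdivision H S] exhibits S as a subdivision of H.  For an edge xy of H,
   [inner x y] lists, from x to y, the internal vertices of the subdivision path
   replacing xy; it is unconstrained when x and y are not adjacent.  Each edge is
   seen in both orientations, which [inner_rev] makes coherent.  The two [_cover]
   fields say that S has no other vertices or edges than those of the paths and
   the original vertices. *)
Record subdivision (H S : sgraph) := Subdivision {
  branch : H -> S;
  inner : H -> H -> seq S;
  sub_path (x y : H) : seq S := branch x :: rcons (inner x y) (branch y);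
  branch_inj : injective branch;
  inner_path : forall x y, x -- y ->
    path (@adj S) (branch x) (rcons (inner x y) (branch y));
  inner_uniq : forall x y, x -- y -> uniq (inner x y);
  inner_rev : forall x y, x -- y -> inner y x = rev (inner x y);
  inner_branch : forall x y z, x -- y -> branch z \notin inner x y;
  inner_disjoint : forall x y u v, x -- y -> u -- v ->
    [set x; y] != [set u; v] -> [disjoint inner x y & inner u v];
  vertex_cover : forall s : S,
    (exists x, s = branch x) \/ (exists x y, x -- y /\ s \in inner x y);
  edge_cover : forall s t : S, s -- t ->
    exists x y, x -- y /\ infix [:: s; t] (sub_path x y)
}.

Definition path_length (H S : sgraph) (D : subdivision H S) (x y : H) : nat :=
  (size (sub_path D x y)).-1.

Definition divisible (q : nat) (H S : sgraph) (D : subdivision H S) : Prop :=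
  forall x y : H, x -- y -> q %| path_length D x y.

(* Up to isomorphism. *)
Definition subgraph (S G : sgraph) : Prop :=
  exists h : S -> G, injective h /\ {homo h : x y / x -- y}.

Definition contains_divisible_subdivision (q : nat) (H G : sgraph) : Prop :=
  exists (S : sgraph) (D : subdivision H S), divisible q D /\ subgraph S G.

Definition forces (H : sgraph) (q f : nat) : Prop :=
  forall G : sgraph, K_minor f G -> contains_divisible_subdivision q H G.

(* [is_f H q f] means f = f(H,q). *)
Definition is_f (H : sgraph) (q f : nat) : Prop :=
  [/\ 0 < f, forces H q f & forall g, 0 < g -> forces H q g -> f <= g].

Lemma is_f_unique (H : sgraph) (q f g : nat) :
  is_f H q f -> is_f H q g -> f = g.
Proof.
move=> [f0 Ff minf] [g0 Fg ming]; apply/eqP.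
by rewrite eqn_leq minf // ming.
Qed.

(* Main.v *)
Require Import Defs.
From mathcomp Require Import all_boot all_order all_algebra.
From mathcomp Require Import zify ring.
From Stdlib Require Import Classical_Prop.

(* A gadget is a union of blocks crossed by paths of several lengths modulo
   q. Fix for each edge of H a disjoint gadget whose set of lengths cannot
   be enlarged by adding seven of the remaining blocks; as this set grows at
   most q - 1 times, 7q blocks per edge suffice. Appending to such a gadget
   a piece that two paths of different lengths cross produces two translates
   of its set of lengths, which must then coincide: modulo the stabilizer K
   of the set, all remaining routes between two given points have the same
   length. Hence among stars (a tripod in a block with a leaf block at each
   tip) the distance L between centers satisfies L(x,z) = L(x,y) + L(y,z)
   and L(x,y) = L(y,x) modulo K, so 2L = 0 and, 'Z_q being cyclic, L splits
   the stars into at most two classes. Taking the branch vertices in the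
   larger class costs 4 blocks for each of twice as many stars. Finally a
   route from x to y through the gadget competes with the direct one, of
   length in K; maximality gives a route of that same length through the
   gadget, hence, moving within K, one of length 0 modulo q. *)

Set Implicit Arguments.
Unset Strict Implicit.
Unset Printing Implicit Defensive.

Import Order.TTheory GRing.Theory Num.Theory.

(** * Paths in vertex sets *)

Section Linkage.
Variable G : sgraph.
Implicit Types (W X Y S : {set G}) (a b c p : G) (n k : nat).

(* Removing a from W makes the walk a path. *)
Fixpoint linked n W a b : bool :=
  (a \in W) &&
  if n is n'.+1 then [exists c, (a -- c) && linked n' (W :\ a) c b]
  else a == b.

Lemma linked0 W a : a \in W -> linked 0 W a a.
Proof. by move=> /= ->; rewrite eqxx. Qed.

Lemma linkedSP n W a b :
  reflect [/\ a \in W & exists2 c, a -- c & linked n (W :\ a) c b]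
          (linked n.+1 W a b).
Proof.
apply: (iffP andP) => [[-> /existsP[c /andP[]]]|[-> [c ac cb]]].
  by split=> //; exists c.
by split=> //; apply/existsP; exists c; rewrite ac.
Qed.

Lemma linked_start n W a b : linked n W a b -> a \in W.
Proof. by case: n => [|n] /= /andP[]. Qed.

Lemma linked_end n W a b : linked n W a b -> b \in W.
Proof.
elim: n W a => [|n IHn] W a; first by case/andP=> aW /eqP<-.
by case/linkedSP=> _ [c _ /IHn]; rewrite inE => /andP[].
Qed.

Lemma linked_sub n W X a b : W \subset X -> linked n W a b -> linked n X a b.
Proof.
elim: n W X a => [|n IHn] W X a sWX.
  by case/andP=> aW /=; rewrite (subsetP sWX).
case/linkedSP=> aW [c ac cb]; apply/linkedSP; split; first exact: (subsetP sWX).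
by exists c => //; apply: IHn cb; apply: setSD.
Qed.

Lemma linked_size n W a b : linked n W a b -> n < #|W|.
Proof.
elim: n W a => [|n IHn] W a; first by case/andP=> aW _; apply/card_gt0P; exists a.
by case/linkedSP=> aW [c _ /IHn]; rewrite (cardsD1 a W) aW.
Qed.

Lemma linked_cat n k X Y a b c :
  linked n X a b -> linked k Y b c -> {in X & Y, forall x y, x = y -> x = b} ->
  linked (n + k) (X :|: Y) a c.
Proof.
elim: n X a => [|n IHn] X a.
  by case/andP=> _ /eqP-> bc _; apply: linked_sub bc; apply: subsetUr.
case/linkedSP=> aX [d ad db] bc XY; rewrite addSn; apply/linkedSP.
have [eab|nab] := eqVneq a b.
  by have := linked_end db; rewrite -eab !inE eqxx.
split; first by rewrite inE aX.
exists d => //; have := IHn _ _ db bc.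
have -> : X :\ a :|: Y = (X :|: Y) :\ a.
  apply/setP=> v; rewrite !inE; case: eqP => //= ->.
  by apply/idP=> aY; rewrite (XY a a) ?eqxx in nab.
apply=> x y; rewrite inE => /andP[_ xX] yY; exact: XY.
Qed.

Lemma linked_jump n k X Y a b c d : linked n X a b -> b -- c -> linked k Y c d ->
  [disjoint X & Y] -> linked (n + k.+1) (X :|: Y) a d.
Proof.
move=> ab bc cd dXY; have [bX cY] := (linked_end ab, linked_start cd).
have bY : b \notin Y by rewrite (disjointFr dXY).
have bd : linked k.+1 (b |: Y) b d.
  apply/linkedSP; rewrite !inE eqxx; split=> //; exists c => //.
  apply: linked_sub cd; apply/subsetP=> v vY.
  by rewrite !inE vY orbT andbT; apply: contraNneq bY => <-.
have -> : X :|: Y = X :|: (b |: Y).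
  by apply/setP=> v; rewrite !inE; case: eqP => // ->; rewrite bX.
apply: linked_cat ab bd _ => x y xX yY exy; move: yY; rewrite -exy !inE.
by rewrite (disjointFr dXY) ?orbF // => /eqP.
Qed.

Lemma linked_rev n W a b : linked n W a b -> linked n W b a.
Proof.
elim: n W a => [|n IHn] W a; first by case/andP=> aW /eqP <- /=; rewrite aW eqxx.
case/linkedSP=> aW [c ac cb].
have ca : linked 0 [set a] a a by apply: linked0; rewrite inE.
have := linked_jump (IHn _ _ cb) _ ca; rewrite adj_sym ac addn1 => /(_ isT).
by rewrite setUC setD1K //; apply; rewrite disjoint_sym disjoints1 !inE eqxx.
Qed.

Lemma linkedP n W a b : linked n W a b ->
  exists s, [&& path (@adj G) a s, last a s == b, uniq (a :: s),
                all (mem W) (a :: s) & size s == n].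
Proof.
elim: n W a => [|n IHn] W a.
  by case/andP=> aW /eqP <-; exists [::]; rewrite /= eqxx aW.
case/linkedSP=> aW [c ac /IHn[s]]; rewrite [uniq _]lock [all _ _]lock.
case/and5P=> pcs ls us ws ss; exists (c :: s); rewrite -!lock in us ws *.
have sW : all (mem W) (c :: s) by apply: sub_all ws => v /setD1P[].
have anc : a \notin c :: s by apply/negP=> /(allP ws); rewrite !inE eqxx.
by rewrite /= ac pcs ls; move: us sW anc => /= -> -> ->; rewrite aW.
Qed.

Lemma path_linked W a s : path (@adj G) a s -> uniq (a :: s) ->
  all (mem W) (a :: s) -> linked (size s) W a (last a s).
Proof.
elim: s W a => [|c s IHs] W a; first by rewrite /= eqxx andbT.
case/andP=> ac cs /andP[anc ucs] /andP[aW csW]; apply/linkedSP; split=> //.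
have {}csW : all (mem W) (c :: s) := csW.
exists c => //; apply: IHs => //; apply/allP=> v vcs.
have vW : v \in W := allP csW v vcs.
by rewrite !inE vW andbT; apply: contraNneq anc => <-.
Qed.

Lemma connected_linked X a b : connected_in X -> a \in X -> b \in X ->
  exists n, linked n X a b.
Proof.
move=> cX aX bX; have /connectP[s ps ->] := cX _ _ aX bX.
have [s' ps' us' _] := shortenP ps; exists (size s').
apply: path_linked => //.
  by apply: sub_path ps' => x y /=; case/andP.
rewrite /= aX; elim: s' a {aX us' ps} ps' => //= c s' IHs a.
by case/andP=> /andP[/andP[_ ->] _] /IHs.
Qed.

(** [X] is the vertex set of a single path from [a] to [b]; each vertex [p] of it cuts the path into
    two pieces sharing only [p]. *)
Lemma linked_thin n W a b : linked n W a b -> exists X : {set G},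
  [/\ X \subset W, a \in X, b \in X & {in X, forall p, exists Y Z i j,
   [/\ Y :|: Z \subset X, Y :&: Z = [set p], linked i Y p a & linked j Z p b]}].
Proof.
elim: n W a => [|n IHn] W a.
  case/andP=> aW /eqP <-; exists [set a].
  rewrite sub1set aW inE eqxx; split=> // p /set1P ->.
  by exists [set a], [set a], 0, 0; rewrite setUid setIid /= inE eqxx.
case/linkedSP=> aW [c ac /IHn[X [sXW cX bX thinX]]].
have aX : a \notin X by apply/negP=> /(subsetP sXW); rewrite !inE eqxx.
exists (a |: X); split; rewrite ?inE ?eqxx ?bX ?orbT //.
  by rewrite subUset sub1set aW (subset_trans sXW) ?subD1set.
move=> p; case/setU1P=> [->|pX].
  have [Y [Z [i [j [sYZ YZ _ cb]]]]] := thinX c cX.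
  have sZ : Z \subset X by apply: subset_trans sYZ; apply: subsetUr.
  have aZ : a \notin Z by apply: contra aX => /(subsetP sZ).
  exists [set a], (a |: Z), 0, j.+1; split; rewrite /= ?inE ?eqxx //.
  - by rewrite setUA setUid setUS.
  - by apply/setP=> v; rewrite !inE; case: eqP.
  - apply/andP; split=> //; apply/existsP; exists c.
    by rewrite ac setU1K.
have [Y [Z [i [j [sYZ YZ pc pb]]]]] := thinX p pX.
exists (Y :|: [set a]), Z, (i + 1), j; split=> //.
- by rewrite setUAC setUC setUS.
- have aZ : a \notin Z.
    by apply: contra aX => aZ; apply: (subsetP sYZ); rewrite inE aZ orbT.
  rewrite setIUl YZ; apply/setP=> v; rewrite !inE.
  by case: (v =P a) => [->|_]; rewrite ?(negbTE aZ) /= orbF.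
have ca : c -- a by rewrite adj_sym.
have la : linked 0 [set a] a a by apply: linked0; rewrite inE.
apply: linked_jump pc ca la _.
rewrite disjoint_sym disjoints1; apply: contra aX => aY.
by apply: (subsetP sYZ); rewrite inE aY.
Qed.

(** Walk from [a] and stop at the first vertex [p] of [S]; the piece walked is returned reversed. *)
Lemma linked_hit n W S a b : linked n W a b -> b \in S -> exists p X k,
  [/\ p \in S, X \subset W, linked k X p a & X :&: S = [set p]].
Proof.
elim: n W a => [|n IHn] W a.
  case/andP=> aW /eqP <- aS; exists a, [set a], 0.
  rewrite aS sub1set aW /= inE eqxx; split=> //.
  by apply/setP=> v; rewrite !inE; case: eqP => // ->.
case/linkedSP=> aW [c ac cb] bS; have [aS|aS] := boolP (a \in S).
  exists a, [set a], 0; rewrite aS sub1set /= inE eqxx; split=> //.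
  by apply/setP=> v; rewrite !inE; case: eqP => // ->.
have [p [X [k [pS sXW pc XS]]]] := IHn _ _ cb bS.
exists p, (X :|: [set a]), (k + 1); split=> //.
- by rewrite subUset sub1set aW (subset_trans sXW) ?subD1set.
- have ca : c -- a by rewrite adj_sym.
  have la : linked 0 [set a] a a by apply: linked0; rewrite inE.
  apply: linked_jump pc ca la _.
  rewrite disjoint_sym disjoints1; apply/negP=> /(subsetP sXW).
  by rewrite !inE eqxx.
- rewrite setIUl XS; apply/setP=> v; rewrite !inE; case: (v =P a) => [->|_].
    by rewrite (negbTE aS) orbF.
  by rewrite orbF.
Qed.

(** Thin out a path between two of the terminals and walk from the third one until it is met, at
    [p]. The path splits at [p] into two arms, and the walk is the last one. An arm may have length
    0. *)
Lemma tripod X (t : 'I_3 -> G) : connected_in X -> (forall i, t i \in X) ->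
  exists p (T : 'I_3 -> {set G}) (m : 'I_3 -> nat),
  [/\ forall i, T i \subset X, forall i, linked (m i) (T i) p (t i)
    & forall i j, i != j -> T i :&: T j = [set p]].
Proof.
move=> cX tX; pose i0 : 'I_3 := ord0; pose i1 : 'I_3 := inord 1.
have [n01 l01] := connected_linked cX (tX i0) (tX i1).
have [Y [sYX t0Y t1Y thinY]] := linked_thin l01.
have [n20 l20] := connected_linked cX (tX ord_max) (tX i0).
have [p [T2 [m2 [pY sT2 l2 T2Y]]]] := linked_hit l20 t0Y.
have [T0 [T1 [m0 [m1 [sTY T01 l0 l1]]]]] := thinY p pY.
have [s0 s1] : T0 \subset Y /\ T1 \subset Y by apply/andP; rewrite -subUset.
have pT0 := linked_start l0; have pT1 := linked_start l1.
have pT2 := linked_start l2.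
have T02 : T2 :&: T0 = [set p].
  apply/eqP; rewrite eqEsubset -{1}T2Y setIS // sub1set inE pT2 pT0 //.
have T12 : T2 :&: T1 = [set p].
  apply/eqP; rewrite eqEsubset -{1}T2Y setIS // sub1set inE pT2 pT1 //.
have I3 (i : 'I_3) : [\/ i = i0, i = i1 | i = ord_max].
  case: i => [[|[|[|//]]] lti]; [apply: Or31|apply: Or32|apply: Or33];
    apply: val_inj => //=; by rewrite inordK.
pose sel U (x y z : U) (i : 'I_3) := if val i == 0 then x else if val i == 1 then y else z.
exists p, (sel _ T0 T1 T2), (sel _ m0 m1 m2).
by split=> [i|i|i j]; case: (I3 i) => ->; try case: (I3 j) => ->;
  rewrite /sel /= ?inordK ?eqxx //= ?(subset_trans _ sYX) // 1?setIC.
Qed.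

End Linkage.

Global Opaque linked.

(** * Stabilizers in cyclic groups *)

Section Stabilizer.
Variable V : finZmodType.
Implicit Types (A B : {set V}) (x y c : V).

Definition translate c A : {set V} := [set (r + c)%R | r in A].

Definition stab A x := translate x A == A.

Lemma card_translate c A : #|translate c A| = #|A|.
Proof. by rewrite card_imset //; apply: addIr. Qed.

Lemma translateD c d A : translate (c + d)%R A = translate d (translate c A).
Proof. by rewrite /translate -imset_comp; apply: eq_imset => r /=; rewrite addrA. Qed.

Lemma translate0 A : translate 0%R A = A.
Proof. by rewrite -[RHS]imset_id; apply: eq_imset => r; rewrite addr0. Qed.

Lemma stab0 A : stab A 0%R.
Proof. by rewrite /stab translate0. Qed.

Lemma stabB A x y : stab A x -> stab A y -> stab A (x - y)%R.
Proof.
by move=> /eqP Ax /eqP Ay; rewrite /stab -{1}Ay -translateD addrC subrK Ax.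
Qed.

Lemma stab_mem A x r : stab A x -> r \in A -> (r + x)%R \in A.
Proof. by move=> /eqP {2}<- rA; apply: imset_f. Qed.

(** Both translates have as many elements as [A], so each fills [B]. Below, [A] is the set of
    lengths of a saturated gadget and [B] that of an enlarged one. *)
Lemma stab_of_translates A B c d : translate c A \subset B ->
  translate d A \subset B -> #|B| <= #|A| -> stab A (c - d)%R.
Proof.
move=> cA dA BA; have /eqP eB : translate c A == B by rewrite eqEcard cA card_translate.
have /eqP : translate d A == B by rewrite eqEcard dA card_translate.
by rewrite /stab translateD eB => <-; rewrite -translateD subrr translate0.
Qed.

End Stabilizer.

Lemma leq_card_setU1 (T : finType) (A : {set T}) x n :
  #|A| <= n -> #|A :|: [set x]| <= n.+1.
Proof.
move=> An; apply: leq_trans (leq_card_setU _ _) _.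
by rewrite cards1 addn1.
Qed.

Lemma third N : 3 <= N -> forall x y : 'I_N, exists2 z, x != z & y != z.
Proof.
move=> N3 x y; have /card_gt0P[z] : 0 < #|~: [set x; y]|.
  by have := cardsC [set x; y]; rewrite card_ord cards2; case: (_ != _); lia.
by rewrite !inE negb_or !(eq_sym z) => /andP[]; exists z.
Qed.

(* Modulo a subgroup, the cyclic group 'Z_q has at most one element of order 2. *)
Lemma double_stable q (K : pred 'Z_q) x y : 1 < q ->
  K 0%R -> (forall c d, K c -> K d -> K (c - d)%R) ->
  K (x + x)%R -> K (y + y)%R -> ~~ K x -> ~~ K y -> K (x + y)%R.
Proof.
move=> q1 K0 KB; have KN c : K c -> K (- c)%R by rewrite -sub0r; apply: KB.
have KD c d : K c -> K d -> K (c + d)%R by move=> Kc /KN; rewrite -{2}[d]opprK; apply: KB.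
have KM c n : K c -> K (c *+ n)%R.
  by move=> Kc; elim: n => // n IHn; rewrite mulrS KD.
have qK : exists n, (0 < n) && K n%:R%R.
  by exists q; rewrite (ltnW q1) -Zp_nat_mod // modnn.
(* The least positive [d] in [K] generates it: [K] holds exactly at the multiples of [d]. *)
have [d /andP[d0 Kd] mind] := ex_minnP qK.
have KE n : K n%:R%R = (d %| n).
  apply/idP/idP => [Kn|/dvdnP[k ->]]; last by rewrite natrM mulr_natl KM.
  rewrite /dvdn; apply: contraTT (ltn_pmod n d0); rewrite -lt0n -leqNgt => nd.
  apply: mind; rewrite nd; have -> : (n %% d)%:R%R = (n%:R - (n %/ d)%:R * d%:R)%R :> 'Z_q.
    by rewrite {2}(divn_eq n d) natrD natrM addrC addKr.
  by apply: KB => //; rewrite mulr_natl KM.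
rewrite -[x]natr_Zp -[y]natr_Zp -!natrD !KE => /dvdnP[k ek] /dvdnP[l el].
(* An even [k] in 2x = kd would put [x] in [K]. So [x] and [y] are both odd multiples of d/2, and
   their sum is a multiple of [d]. *)
move=> nx ny; have ok : odd k.
  apply: contraR nx => /negbTE ke; rewrite -[k]odd_double_half ke in ek.
  by apply/dvdnP; exists k./2; lia.
have ol : odd l.
  apply: contraR ny => /negbTE le; rewrite -[l]odd_double_half le in el.
  by apply/dvdnP; exists l./2; lia.
rewrite -[k]odd_double_half ok in ek; rewrite -[l]odd_double_half ol in el.
by apply/dvdnP; exists (k./2 + l./2).+1; lia.
Qed.

(** [lam x i y j] stands for the length of a route leaving star [x] by arm [i] and reaching star [y]
    by arm [j]; additivity asks for [j != j'] because the route crosses [y] along two different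
    arms. Modulo [K] the arms turn out not to matter. *)
Lemma two_classes q N (K : pred 'Z_q) (lam : 'I_N -> 'I_3 -> 'I_N -> 'I_3 -> 'Z_q) :
  1 < q -> 3 <= N -> K 0%R -> (forall c d, K c -> K d -> K (c - d)%R) ->
  (forall x y z i j j' k, x != y -> y != z -> x != z -> j != j' ->
     K (lam x i z k - (lam x i y j + lam y j' z k))%R) ->
  (forall x y i j, x != y -> K (lam x i y j - lam y j x i)%R) ->
  exists C : {set 'I_N}, N <= 2 * #|C| /\
    {in C &, forall x y, x != y -> forall i j, K (lam x i y j)}.
Proof.
move=> q1 N3 K0 KB add sym.
have KN c : K c -> K (- c)%R by rewrite -sub0r; apply: KB.
have KD c d : K c -> K d -> K (c + d)%R by move=> Kc /KN; rewrite -{2}[d]opprK; apply: KB.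
have third3 (i i' : 'I_3) := third (isT : 3 <= 3) i i'.
(* Come to [y] from a third star along an arm other than [j] and [j']; leaving by [j] or by [j']
   then gives the same total. *)
have indepl y z j j' k : y != z -> K (lam y j z k - lam y j' z k)%R.
  move=> nyz; have [x nyx nzx] := third N3 y z.
  have [i ni ni'] := third3 j j'; rewrite eq_sym in nyx; rewrite eq_sym in nzx.
  rewrite eq_sym in ni; rewrite eq_sym in ni'.
  have := KB _ _ (add x y z i i j' k nyx nyz nzx ni') (add x y z i i j k nyx nyz nzx ni).
  by congr K; ring.
have indep y z j j' k k' : y != z -> K (lam y j z k - lam y j' z k')%R.
  move=> nyz; have nzy : z != y by rewrite eq_sym.
  have h1 := indepl y z j j' k nyz; have h2 := sym y z j' k nyz.
  have h3 := indepl z y k k' j' nzy; have h4 := sym z y k' j' nzy.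
  by have := KD _ _ (KD _ _ h1 h2) (KD _ _ h3 h4); congr K; ring.
pose L x y := lam x ord0 y ord0.
have LE x y i j : x != y -> K (L x y) -> K (lam x i y j).
  by move=> nxy KL; have := KD _ _ (indep x y i ord0 j ord0 nxy) KL; congr K; rewrite /L; ring.
have Ladd x y z : x != y -> y != z -> x != z -> K (L x z - (L x y + L y z))%R.
  move=> nxy nyz nxz; have h := add x y z ord0 ord0 ord_max ord0 nxy nyz nxz isT.
  have := KD _ _ h (indep y z ord_max ord0 ord0 ord0 nyz).
  by congr K; rewrite /L; ring.
(* Adding the relations for x, z, y and for x, y, z cancels the lengths from [x] and leaves L(y,z) +
   L(z,y) in [K]. *)
have L2 y z : y != z -> K (L y z + L y z)%R.
  move=> nyz; have [x nyx nzx] := third N3 y z.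
  have nzy : z != y by rewrite eq_sym.
  rewrite eq_sym in nyx; rewrite eq_sym in nzx.
  have h := KD _ _ (Ladd x z y nzx nzy nyx) (Ladd x y z nyx nyz nzx).
  have := KB _ _ (sym y z ord0 ord0 nyz) h.
  by congr K; rewrite /L; ring.
pose x0 : 'I_N := Ordinal (ltn_trans (isT : 0 < 2) N3).
(* [x0] is put in by hand, since the hypotheses say nothing of [lam] between a star and itself. *)
pose C := [set y | (y == x0) || K (L x0 y)].
have LK y z : y \in C -> z \in C -> y != z -> K (L y z).
  rewrite !inE; case: (eqVneq y x0) => [-> _|nyx Ky].
    by case: (eqVneq z x0) => [->|]; rewrite ?eqxx.
  case: (eqVneq z x0) => [-> _ _|nzx Kz nyz].
    have nxy : x0 != y by rewrite eq_sym.
    have := KD _ _ Ky (sym y x0 ord0 ord0 nyx).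
    by congr K; rewrite /L; ring.
  rewrite eq_sym in nyx; rewrite eq_sym in nzx.
  have := KB _ _ (KB _ _ Kz Ky) (Ladd x0 y z nyx nyz nzx).
  by congr K; ring.
(* From [x0] to a star outside [C] the length has order two modulo [K], and two such lengths add up
   to an element of [K]. *)
have LK' y z : y \in ~: C -> z \in ~: C -> y != z -> K (L y z).
  rewrite !inE !negb_or ![_ == x0]eq_sym => /andP[nyx nKy] /andP[nzx nKz] nyz.
  have h := double_stable q1 K0 KB (L2 x0 y nyx) (L2 x0 z nzx) nKy nKz.
  have := KB _ _ (KB _ _ h (L2 x0 y nyx)) (Ladd x0 y z nyx nyz nzx).
  by congr K; ring.
have := cardsC C; rewrite card_ord => cC.
have [le|/ltnW le] := leqP #|~: C| #|C|.
  exists C; split; last by move=> y z yC zC nyz i j; apply: LE => //; apply: LK.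
  by rewrite mul2n -addnn -{1}cC leq_add2l.
exists (~: C); split; last by move=> y z yC zC nyz i j; apply: LE => //; apply: LK'.
by rewrite mul2n -addnn -{1}cC leq_add2r.
Qed.

(** List the blocks and cut the list into runs of four: the first of each run is a hub, the other
    three are its leaves. *)
Lemma exists_blocks (T : finType) (R : {set {set T}}) N : 4 * N <= #|R| ->
  exists (hub : 'I_N -> {set T}) (leaf : 'I_N -> 'I_3 -> {set T}),
  [/\ forall x, hub x \in R, forall x i, leaf x i \in R,
      forall x y, (hub x == hub y) = (x == y),
      forall x y i j, (leaf x i == leaf y j) = (x == y) && (i == j)
    & forall x y i, (hub x == leaf y i) = false].
Proof.
move=> RN; pose b (x : 'I_N) (k : nat) := nth set0 (enum R) (4 * x + k).
have lt (x : 'I_N) k : k < 4 -> 4 * x + k < size (enum R).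
  by rewrite -cardE => k4; have := ltn_ord x; lia.
have bR x k : k < 4 -> b x k \in R by move=> k4; rewrite -mem_enum mem_nth ?lt.
have bE x y k l : k < 4 -> l < 4 -> (b x k == b y l) = (x == y) && (k == l).
  move=> k4 l4; rewrite nth_uniq ?lt ?enum_uniq // -val_eqE /=.
  by apply/eqP/andP => [e|[/eqP-> /eqP->]] //; split; apply/eqP; lia.
have lt4 (i : 'I_3) : i.+1 < 4 by rewrite ltnS ltn_ord.
exists (fun x => b x 0), (fun x i => b x i.+1); split=> [x|x i|x y|x y i j|x y i].
- exact: bR.
- exact: bR.
- by rewrite bE ?andbT.
- by rewrite bE ?lt4.
- by rewrite bE ?lt4 ?andbF.
Qed.

(** * Gadgets and stars *)

Section Blocks.
Variables (G : sgraph) (P : {set {set G}}).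
Hypothesis trivP : trivIset P.
Hypothesis connP : {in P, forall X : {set G}, connected_in X}.
Hypothesis edgeP : {in P &, forall X Y : {set G}, X != Y ->
  exists x y, [/\ x \in X, y \in Y & x -- y]}.
Implicit Types (X Y I J : {set G}) (Q R L F : {set {set G}}) (a b s t : G).

Lemma block_disjoint X Y : X \in P -> Y \in P -> X != Y -> [disjoint X & Y].
Proof. exact: (trivIsetP trivP). Qed.

Lemma cover_disjoint Q R : Q \subset P -> R \subset P -> [disjoint Q & R] ->
  [disjoint cover Q & cover R].
Proof.
move=> sQ sR dQR; apply/pred0P=> v /=; apply/negP.
case/andP=> /bigcupP[X XQ vX] /bigcupP[Y YR vY].
have nXY : X != Y by apply: contraTneq XQ => ->; rewrite (disjointFl dQR).
by rewrite (disjointFr (block_disjoint (subsetP sQ _ XQ) (subsetP sR _ YR) nXY)) in vY.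
Qed.

Lemma block_sub_cover X Q : X \in Q -> X \subset cover Q.
Proof. exact: bigcup_sup. Qed.

Lemma cover_sub Q R : Q \subset R -> cover Q \subset cover R.
Proof. by move=> sQR; apply/bigcupsP=> X /(subsetP sQR); apply: bigcup_sup. Qed.

Lemma bridge X Y a b : X \in P -> Y \in P -> X != Y -> a \in X -> b \in Y ->
  exists n, linked n (X :|: Y) a b.
Proof.
move=> XP YP nXY aX bY; have [x [y [xX yY xy]]] := edgeP XP YP nXY.
have [i ax] := connected_linked (connP XP) aX xX.
have [j yb] := connected_linked (connP YP) yY bY.
by exists (i + j.+1); apply: linked_jump ax xy yb _; apply: block_disjoint.
Qed.

Definition touches a X := [exists x in X, a -- x].

Lemma touchesP a X : reflect (exists2 x, x \in X & a -- x) (touches a X).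
Proof. exact: exists_inP. Qed.

Variable q : nat.
Hypothesis q_gt1 : 1 < q.

(** The bound [#|G|] makes the search finite and excludes no path, by [linked_size]. *)
Definition lengths W a b : {set 'Z_q} :=
  [set r | [exists n : 'I_(#|G|), linked n W a b && (n%:R%R == r)]].

Lemma lengthsP W a b r :
  reflect (exists2 n, linked n W a b & r = n%:R%R) (r \in lengths W a b).
Proof.
rewrite inE; apply: (iffP existsP) => [[n /andP[abn /eqP <-]]|[n abn ->]].
  by exists n.
have ltn : n < #|G| by apply: leq_trans (linked_size abn) (max_card _).
by exists (Ordinal ltn); rewrite abn eqxx.
Qed.

Lemma lengths_translate k W a b W' a' b' :
  (forall n, linked n W a b -> linked (n + k) W' a' b') ->
  translate k%:R%R (lengths W a b) \subset lengths W' a' b'.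
Proof.
move=> WW'; apply/subsetP=> _ /imsetP[_ /lengthsP[n abn ->] ->].
by apply/lengthsP; exists (n + k); rewrite ?natrD //; apply: WW'.
Qed.

(* A gadget (Q, (I, J), (a, b)) is a set Q of blocks with two ends I and J in Q
   and two vertices a, b of its core (the union of the other blocks), adjacent
   to I and J respectively: it is used by entering through I, following a path
   of the core from a to b and leaving through J. *)
Definition gadget : Type :=
  ({set {set G}} * ({set G} * {set G}) * (G * G))%type.
Implicit Type g : gadget.

Definition gset g := g.1.1.
Definition gin g := g.1.2.1.
Definition gout g := g.1.2.2.
Definition gcore g := cover (gset g :\: [set gin g; gout g]).
Definition glengths g := lengths (gcore g) g.2.1 g.2.2.

Definition richness g : nat := #|glengths g|.

Definition gadget_in F g :=
  [&& gset g \subset F, gin g \in gset g, gout g \in gset g, gin g != gout g,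
      g.2.1 \in gcore g, g.2.2 \in gcore g,
      touches g.2.1 (gin g) & touches g.2.2 (gout g)].

(** [g'] ranges over all gadgets in [F], not only enlargements of [g]. The slack 7 is what
    [saturated_series] uses; [saturated_parallel] adds six blocks. *)
Definition saturated F g := forall g',
  gadget_in F g' -> #|gset g'| <= #|gset g| + 7 -> richness g' <= richness g.

Lemma gadget_in_sub F F' g : F \subset F' -> gadget_in F g -> gadget_in F' g.
Proof. by move=> sF /andP[sgF gF]; apply/andP; rewrite (subset_trans sgF). Qed.

(** The core is connected: its blocks are connected and any two of them are joined by an edge. *)
Lemma glengths_gt0 F g : F \subset P -> gadget_in F g -> 0 < richness g.
Proof.
case: g => [[Q [I J]] [a b]] sFP /and5P[/= sQ _ _ _ /and4P[aW bW _ _]].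
have sWP : gset (Q, (I, J), (a, b)) :\: [set I; J] \subset P.
  by apply: subset_trans (subset_trans sQ sFP); apply: subsetDl.
have [X XQ aX] := bigcupP aW; have [Y YQ bY] := bigcupP bW.
have [XP YP] := (subsetP sWP _ XQ, subsetP sWP _ YQ).
suff [n abn] : exists n, linked n (gcore (Q, (I, J), (a, b))) a b.
  by apply/card_gt0P; exists n%:R%R; apply/lengthsP; exists n.
have [eXY|nXY] := eqVneq X Y.
  rewrite -eXY in bY; have [n abn] := connected_linked (connP XP) aX bY.
  by exists n; apply: linked_sub abn; apply: block_sub_cover.
have [n abn] := bridge XP YP nXY aX bY.
exists n; apply: linked_sub abn; rewrite subUset.
by apply/andP; split; apply: block_sub_cover.
Qed.

Lemma exists_gadget F : F \subset P -> 3 <= #|F| ->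
  exists2 g, gadget_in F g & #|gset g| = 3.
Proof.
move=> sFP F3; have [s [us s3 sF]] : exists s : seq {set G},
    [/\ uniq s, size s = 3 & {subset s <= F}].
  exists (take 3 (enum F)); rewrite take_uniq ?enum_uniq // size_take -cardE.
  split=> //; first exact/minn_idPl.
  by move=> X /mem_take; rewrite mem_enum.
case: s us s3 sF => [|I [|J [|X [|//]]]] //= /and3P[]; rewrite !inE negb_or.
case/andP=> nIJ nIX nJX _ _ sF.
have [IF JF XF] : [/\ I \in F, J \in F & X \in F] by split; apply: sF; rewrite !inE eqxx ?orbT.
have [IP JP XP] : [/\ I \in P, J \in P & X \in P] by split; apply: (subsetP sFP).
rewrite eq_sym in nIX; rewrite eq_sym in nJX.
have [a [i [aX iI ai]]] := edgeP XP IP nIX.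
have [b [j [bX jJ bj]]] := edgeP XP JP nJX.
exists (X |: [set I; J], (I, J), (a, b)); last first.
  by rewrite cardsU1 cards2 !inE negb_or nIX nJX nIJ.
rewrite /gadget_in /gcore /gset /gin /gout /=.
have sX : X \subset cover ((X |: [set I; J]) :\: [set I; J]).
  by apply: block_sub_cover; rewrite !inE eqxx negb_or nIX nJX.
rewrite !(subsetP sX) // nIJ !inE !eqxx !orbT /= !subUset !sub1set XF IF JF /=.
by apply/andP; split; apply/touchesP; [exists i|exists j].
Qed.

(* Maximizing the number of lengths subject to 7 |glengths g| >= |gset g| + 4
   makes the gadget saturated: seven more blocks may not add a length. *)
Lemma exists_saturated F : F \subset P -> 3 <= #|F| ->
  exists g, [/\ gadget_in F g, saturated F g & #|gset g| <= 7 * q].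
Proof.
move=> sFP F3; have [g0 g0F g03] := exists_gadget sFP F3.
(* The constant 4 is 7 - 3: the initial gadget has three blocks and at least one length. *)
pose pr g := gadget_in F g && (#|gset g| + 4 <= 7 * richness g).
have pr0 : pr g0.
  by rewrite /pr g0F g03; apply: leq_pmulr (glengths_gt0 sFP g0F).
have [g /andP[gF bg] maxg] := @arg_maxnP _ g0 pr richness pr0.
exists g; split=> // [g' g'F g'g|].
  rewrite leqNgt; apply/negP=> lt.
  have pr' : pr g' by rewrite /pr g'F; lia.
  by have /= := maxg g' pr'; rewrite leqNgt lt.
have: richness g <= q.
  by apply: leq_trans (max_card _) _; rewrite card_ord Zp_cast.
by move: bg; lia.
Qed.

(** Gadgets are extracted one at a time from what remains. Saturation in a pool passes to smaller
    pools, so the earlier gadgets stay saturated relative to the final [R]. *)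
Lemma exists_gadgets k F : F \subset P -> 7 * q * k + 3 <= #|F| ->
  exists (g : nat -> gadget) R,
  [/\ R \subset F, #|F| <= #|R| + 7 * q * k,
      forall i, i < k -> [/\ gadget_in F (g i), [disjoint gset (g i) & R]
                         & saturated (gset (g i) :|: R) (g i)]
    & forall i j, i < j -> j < k -> [disjoint gset (g i) & gset (g j)]].
Proof.
move=> sFP; elim: k => [|k IHk] Fk.
  (* [g0] is only a default value for the sequence; the summand 3 provides it. *)
  rewrite muln0 in Fk; have [g0 _ _] := exists_gadget sFP Fk.
  by exists (fun=> g0), F; split=> //; rewrite muln0 addn0.
have [|g [R [sRF cR gP dg]]] := IHk; first by lia.
have R3 : 3 <= #|R| by lia.
have [h [hR satR cg]] := exists_saturated (subset_trans sRF sFP) R3.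
have sh : gset h \subset R by case/andP: hR.
exists (fun i => if i == k then h else g i), (R :\: gset h); split.
- by apply: subset_trans sRF; apply: subsetDl.
- by have := cardsID (gset h) R; rewrite (setIidPr sh); lia.
- move=> i; rewrite ltnS leq_eqVlt; case: eqP => [_ _|_ /= ltik].
    split; first exact: gadget_in_sub hR.
      by rewrite disjoints_subset setCD subsetUr.
    suff -> : gset h :|: R :\: gset h = R by [].
    by rewrite -{2}(setID R (gset h)) (setIidPr sh).
  have [giF dgi sati] := gP i ltik; split=> //.
    by apply: disjointWr dgi; apply: subsetDl.
  move=> g' g'F; apply: sati; apply: gadget_in_sub g'F.
  by apply: setUS; apply: subsetDl.
- move=> i j ltij; rewrite ltnS leq_eqVlt; case: eqP => [ejk _|_ /= ltjk].
    rewrite ltn_eqF -?ejk //; have [_ dgi _] := gP i ltac:(lia).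
    exact: disjointWr sh dgi.
  by rewrite ltn_eqF ?(ltn_trans ltij ltjk) //; apply: dg.
Qed.

Lemma disjoint_setUl X Y I :
  [disjoint X :|: Y & I] = [disjoint X & I] && [disjoint Y & I].
Proof. by rewrite !disjoints_subset subUset. Qed.

Lemma cover2 X Y : cover [set X; Y] = X :|: Y.
Proof. by rewrite /cover bigcup_setU !big_set1. Qed.

Lemma cover_setU Q R : cover (Q :|: R) = cover Q :|: cover R.
Proof. exact: bigcup_setU. Qed.

(** * Extending a saturated gadget in series and in parallel *)

Section Saturated.
Variables (R : {set {set G}}) (g : gadget).
Hypotheses (sRP : R \subset P) (gP : gadget_in P g).
Hypotheses (dgR : [disjoint gset g & R]) (satg : saturated (gset g :|: R) g).

Lemma gset_neq X Y : X \in gset g -> Y \in R -> X != Y.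
Proof. by move=> Xg; apply: contraTneq => <-; rewrite (disjointFr dgR). Qed.

Lemma gcore_sub : gcore g \subset cover (gset g).
Proof. by apply: cover_sub; apply: subsetDl. Qed.

(** The enlarged gadget crosses the core of [g], its former exit, [I], then [L] from [s] to [t], and
    leaves by [J]. The two ways through [L] give two translates of [glengths g] among its lengths,
    and saturation leaves room for only one. *)
Lemma saturated_series L I J s t n1 n2 :
  L \subset R -> #|L| <= 5 -> I \in R -> J \in R -> I \notin L -> J \notin L ->
  I != J -> touches s I -> touches t J ->
  linked n1 (cover L) s t -> linked n2 (cover L) s t ->
  stab (glengths g) (n1%:R - n2%:R)%R.
Proof.
move=> sLR cL IR JR nIL nJL nIJ tsI ttJ l1 l2.
have [/= sgP ging goutg nio /and4P[ga gb tai tbo]] := and5P gP.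
pose g' : gadget := (gset g :|: (L :|: [set I; J]), (gin g, J), (g.2.1, t)).
have sIJ : [set I; J] \subset R by rewrite subUset !sub1set IR.
have sLIJ : L :|: [set I; J] \subset R by rewrite subUset sLR.
have sLP := subset_trans sLR sRP.
have sW : gcore g :|: (gout g :|: I) :|: cover L \subset gcore g'.
  rewrite /gcore -(cover2 _ I) -!cover_setU; apply: cover_sub; apply/subsetP=> X.
  rewrite !inE -!orbA => /or4P[/andP[/norP[Xi Xo] Xg]|/eqP->|/eqP->|XL].
  - by rewrite Xg (negbTE Xi) gset_neq.
  - by rewrite goutg [_ == gin g]eq_sym (negbTE nio) gset_neq.
  - by rewrite eqxx !orbT eq_sym (negbTE (gset_neq ging IR)) nIJ.
  - have XR := subsetP sLR _ XL.
    rewrite XL orbT eq_sym (negbTE (gset_neq ging XR)) andbT /=.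
    by apply: contraNneq nJL => eXJ; rewrite -[J]/(gout g') -eXJ.
have [o oo bo] := touchesP _ _ tbo; have [i iI si] := touchesP _ _ tsI.
have goP : gout g \in P by apply: (subsetP sgP).
have [k0 l0] := bridge goP (subsetP sRP _ IR) (gset_neq goutg IR) oo iI.
have sWP : gset g :\: [set gin g; gout g] \subset P.
  by apply: subset_trans sgP; apply: subsetDl.
have d1 : [disjoint gcore g & gout g :|: I].
  rewrite -(cover2 _ I); apply: cover_disjoint => //.
    by rewrite subUset !sub1set goP (subsetP sRP).
  rewrite disjoint_subset; apply/subsetP=> X; rewrite !inE !negb_or.
  case/andP=> /andP[_ ->] Xg; exact: gset_neq.
have d2 : [disjoint gcore g :|: (gout g :|: I) & cover L].
  rewrite -(cover2 _ I) -cover_setU; apply: cover_disjoint => //.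
    by rewrite !subUset !sub1set goP (subsetP sRP) // sWP.
  rewrite disjoint_subset; apply/subsetP=> X; rewrite !inE.
  case/or3P=> [/andP[_ Xg]|/eqP->|/eqP->] //; apply/negP=> /(subsetP sLR) XR.
    by have := gset_neq Xg XR; rewrite eqxx.
  by have := gset_neq goutg XR; rewrite eqxx.
have shift n : linked n (cover L) s t -> forall k,
  linked k (gcore g) g.2.1 g.2.2 -> linked (k + (k0.+2 + n)) (gcore g') g.2.1 t.
  move=> st k ab; have is_ : i -- s by rewrite adj_sym.
  have := linked_jump (linked_jump ab bo l0 d1) is_ st d2.
  have -> : k + k0.+1 + n.+1 = k + (k0.+2 + n) by rewrite !addnS !addSn addnA.
  exact: linked_sub.
have := stab_of_translates (lengths_translate (shift _ l1)) (lengths_translate (shift _ l2)).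
(* The [k0.+2] edges between the core of [g] and [s] are common to both ways and cancel. *)
rewrite !natrD opprD addrACA subrr add0r; apply.
apply: (satg (g' := g')); last first.
  rewrite /gset /=; apply: leq_trans (leq_card_setU _ _) _.
  rewrite leq_add2l; apply: leq_trans (leq_card_setU _ _) _.
  by apply: (@leq_add _ _ 5 2) => //; rewrite cards2 nIJ.
rewrite /gadget_in /gin /gout /= !inE ging eqxx !orbT (gset_neq ging JR) /=.
rewrite tai ttJ !andbT; apply/and3P; split.
- by rewrite /gset /= setUS.
- by apply: (subsetP sW); rewrite inE inE ga.
- by apply: (subsetP sW); rewrite inE (linked_end l1) orbT.
Qed.

Lemma R_cover_disjoint Q : Q \subset R -> [disjoint cover (gset g) & cover Q].
Proof.
move=> sQ; have [sgP _ _ _ _] := and5P gP.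
by apply: cover_disjoint (disjointWr sQ dgR) => //; apply: subset_trans sRP.
Qed.

(* Rerouting the connection u, v through the gadget: otherwise the gadget could
   be enlarged into one that offers the direct connection as a new length. *)
Lemma saturated_parallel A A' I B B' J s u0 u t v0 v n1 n2 r z :
  uniq [:: A; A'; I; B; B'; J] -> {subset [:: A; A'; I; B; B'; J] <= R} ->
  linked n1 A s u0 -> u0 -- u -> u \in A' -> touches s I ->
  linked n2 B v0 t -> v -- v0 -> v \in B' -> touches t J ->
  linked r (A' :|: B') u v -> stab (glengths g) z ->
  exists2 n, linked n (A' :|: (cover (gset g) :|: B')) u v
           & (n%:R = r%:R + z :> 'Z_q)%R.
Proof.
move=> /= /and5P[]; rewrite !inE !negb_or => /and5P[nAA' nAI nAB nAB' nAJ].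
case/and4P=> nA'I nA'B nA'B' nA'J /and3P[nIB nIB' nIJ] /andP[nBB' nBJ].
case/andP=> nB'J _ sR lA u0u uA' tsI lB vv0 vB' ttJ luv stz.
have [[AR A'R IR] [BR B'R JR]] :
    [/\ A \in R, A' \in R & I \in R] /\ [/\ B \in R, B' \in R & J \in R].
  by do 2!split; apply: sR; rewrite !inE eqxx ?orbT.
have [AP A'P BP B'P] : [/\ A \in P, A' \in P, B \in P & B' \in P].
  by split; apply: (subsetP sRP).
have [/= sgP ging goutg nio /and4P[ga gb tai tbo]] := and5P gP.
have [i ii ai] := touchesP _ _ tai; have [o oo bo] := touchesP _ _ tbo.
have giP := subsetP sgP _ ging; have goP := subsetP sgP _ goutg.
have nA'i : A' != gin g by rewrite eq_sym gset_neq.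
have noB' : gout g != B' by rewrite gset_neq.
have [k1 l1] := bridge A'P giP nA'i uA' ii.
have [k2 l2] := bridge goP B'P noB' oo vB'.
have ia : i -- g.2.1 by rewrite adj_sym.
have sgcP : gset g :\: [set gin g; gout g] \subset P.
  by apply: subset_trans sgP; apply: subsetDl.
have d1 : [disjoint A' :|: gin g & gcore g].
  rewrite -cover2; apply: cover_disjoint => //.
    by rewrite subUset !sub1set A'P.
  rewrite disjoint_sym disjoint_subset; apply/subsetP=> X; rewrite !inE !negb_or.
  by case/andP=> /andP[-> _] Xg; rewrite gset_neq.
have d2 : [disjoint A' :|: gin g :|: gcore g & gout g :|: B'].
  rewrite -(cover2 _ (gin g)) -(cover2 _ B') -cover_setU; apply: cover_disjoint => //.
    by rewrite !subUset !sub1set A'P giP sgcP.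
    by rewrite subUset !sub1set goP.
  rewrite disjoint_subset; apply/subsetP=> X; rewrite !inE !negb_or.
  case/orP=> [/orP[]/eqP->|/andP[/andP[_ ->] Xg]]; last by rewrite gset_neq.
    by rewrite nA'B' eq_sym gset_neq.
  by rewrite nio gset_neq.
pose W := A' :|: (cover (gset g) :|: B').
have through k : linked k (gcore g) g.2.1 g.2.2 ->
    linked (k + (k1 + k2).+2) W u v.
  move=> ab; have := linked_jump (linked_jump l1 ia ab d1) bo l2 d2.
  have -> : k1 + k.+1 + k2.+1 = k + (k1 + k2).+2.
    by rewrite !addnS addSn addnA (addnC k).
  apply: linked_sub; rewrite -!setUA setUS //.
  rewrite !setUA setSU // !subUset gcore_sub !block_sub_cover //.
(* The enlarged gadget has ends [I] and [J]; between them one crosses [A], then takes the detour or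
   the direct connection from [u] to [v], then crosses [B]. *)
pose Q' := gset g :|: [set A; A'; I; B; B'; J].
pose g' : gadget := (Q', (I, J), (s, t)).
have sg'R : [set A; A'; I; B; B'; J] \subset R.
  by rewrite !subUset !sub1set AR A'R IR BR B'R.
have sW : A :|: (W :|: B) \subset gcore g'.
  have sub X : X \in Q' -> X != I -> X != J -> X \subset gcore g'.
    by move=> XQ XI XJ; apply: block_sub_cover; rewrite in_setD XQ !inE negb_or XI XJ.
  have sub' X : X \in gset g -> X \subset gcore g'.
    by move=> Xg; apply: sub; rewrite ?gset_neq // inE Xg.
  have subg : cover (gset g) \subset gcore g' by apply/bigcupsP.
  rewrite !subUset subg !sub // ?inE ?eqxx ?orbT //; by rewrite eq_sym.
have dW X : X \in R -> X != A' -> X != B' -> [disjoint W & X].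
  move=> XR XA XB; have XP := subsetP sRP _ XR.
  rewrite eq_sym in XA; rewrite eq_sym in XB; rewrite !disjoint_setUl.
  rewrite (block_disjoint A'P XP XA) (block_disjoint B'P XP XB) andbT /=.
  have := R_cover_disjoint (Q := [set X]); rewrite cover1; apply.
  by rewrite sub1set.
have dB : [disjoint W & B] by apply: dW => //; rewrite eq_sym.
have dA : [disjoint A & W :|: B].
  by rewrite disjoint_sym disjoint_setUl dW // block_disjoint // eq_sym.
have ext n : linked n W u v -> linked (n + (n1 + n2).+2) (gcore g') s t.
  move=> uv; apply: linked_sub sW _.
  have := linked_jump lA u0u (linked_jump uv vv0 lB dB) dA.
  have -> // : n1 + (n + n2.+1).+1 = n + (n1 + n2).+2.
  by rewrite !addnS addnCA.
have sA'B'W : A' :|: B' \subset W by rewrite setUS // subsetUr.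
(* Detours alone realize a translate of [glengths g]; by saturation [g'] has no other length. *)
have sub1 : translate ((k1 + k2).+2 + (n1 + n2).+2)%:R%R (glengths g) \subset glengths g'.
  by apply: lengths_translate => k /through /ext; rewrite addnA.
have le : richness g' <= richness g.
  apply: satg.
    rewrite /gadget_in /gin /gout /gset /= setUS // !inE nIJ !eqxx !orbT /=.
    rewrite tsI ttJ !andbT; have sA := subset_trans (subsetUl _ _) sW.
    have sB : B \subset gcore g'.
      by apply: subset_trans sW; rewrite setUA subsetUr.
    by rewrite (subsetP sA _ (linked_start lA)) (subsetP sB _ (linked_end lB)).
  apply: leq_trans (leq_card_setU _ _) _; rewrite leq_add2l.
  by do 5!apply: leq_card_setU1; rewrite cards1.
have /eqP e1 : translate ((k1 + k2).+2 + (n1 + n2).+2)%:R%R (glengths g) == glengths g'.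
  by rewrite eqEcard sub1 card_translate.
(* So the direct connection is as long, modulo [q], as some detour, whose core length can then be
   shifted by [z] within [glengths g]. *)
have : (r + (n1 + n2).+2)%:R%R \in glengths g'.
  by apply/lengthsP; exists (r + (n1 + n2).+2) => //; apply: ext (linked_sub sA'B'W luv).
rewrite -e1 => /imsetP[x xg]; rewrite !natrD.
move=> e; have er : (r%:R = x + (k1 + k2).+2%:R)%R.
  by rewrite -[LHS](addrK (n1 + n2).+2%:R%R) e addrA addrK.
have := stab_mem stz xg; case/lengthsP=> k lk ek.
exists (k + (k1 + k2).+2); first exact: through.
by rewrite natrD -ek addrAC -er.
Qed.

End Saturated.

(** Passes from lengths between feet to lengths between centers: the outer arms, of lengths [c] and
    [d], cancel. *)
Lemma route_lengths (A : comPzRingType) (r r1 r2 a b c d : nat) :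
  (r%:R - (r1 + r2 + (a + b).+2)%:R = (r + c + d).+2%:R -
    ((r1 + c + a).+2%:R + (r2 + b + d).+2%:R) :> A)%R.
Proof. by rewrite -!(addn2 (_ + _)) !natrD; ring. Qed.

(** Shifting [r] by minus the length between centers leaves exactly what the two arms and the two
    edges from tip to foot compensate. *)
Lemma reroute_lengths (A : comPzRingType) (n r a b : nat) :
  (n%:R = r%:R + (0 - (r + a + b).+2%:R) :> A -> (a + n.+1 + b.+1)%:R = 0 :> A)%R.
Proof.
by move=> e; rewrite -[n.+1]addn1 -[b.+1]addn1 !natrD e -(addn2 (_ + _)) !natrD; ring.
Qed.

(** * Stars and the routes between them *)

Record star := Star {
  center : G;
  arm : 'I_3 -> {set G};
  arm_len : 'I_3 -> nat;
  tip : 'I_3 -> G;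
  foot : 'I_3 -> G
}.

Definition star_in X (L : 'I_3 -> {set G}) S :=
  [/\ forall i, arm S i \subset X,
      forall i, linked (arm_len S i) (arm S i) (center S) (tip S i),
      forall i j, i != j -> arm S i :&: arm S j = [set center S],
      forall i, tip S i -- foot S i
    & forall i, foot S i \in L i].

(** An edge from [X] to each leaf block provides a tip and a foot; [tripod] joins the tips inside
    [X]. *)
Lemma exists_star X (L : 'I_3 -> {set G}) : X \in P -> (forall i, L i \in P) ->
  (forall i, X != L i) -> exists S, star_in X L S.
Proof.
move=> XP LP nXL.
have ex i : exists e : G * G, [&& e.1 \in X, e.2 \in L i & e.1 -- e.2].
  have [x [y [xX yL xy]]] := edgeP XP (LP i) (nXL i).
  by exists (x, y); rewrite xX yL.
have [e eP] := fin_all_exists ex.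
have [|p [T [m [sT lT dT]]]] := tripod (t := fun i => (e i).1) (connP XP).
  by move=> i; case/and3P: (eP i).
exists (Star p T m (fun i => (e i).1) (fun i => (e i).2)).
by split=> //= i; case/and3P: (eP i).
Qed.

Section Stars.
Variables (R : {set {set G}}) (N : nat).
Variables (hub : 'I_N -> {set G}) (leaf : 'I_N -> 'I_3 -> {set G}).
Variable st : 'I_N -> star.
Hypotheses (sRP : R \subset P).
Hypotheses (hubR : forall x, hub x \in R) (leafR : forall x i, leaf x i \in R).
Hypothesis hub_eq : forall x y, (hub x == hub y) = (x == y).
Hypothesis leaf_eq : forall x y i j, (leaf x i == leaf y j) = (x == y) && (i == j).
Hypothesis hub_leaf : forall x y i, (hub x == leaf y i) = false.
Hypothesis stP : forall x, star_in (hub x) (leaf x) (st x).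
Implicit Types (x y z : 'I_N) (i j k : 'I_3).

Lemma leaf_hub x y i : (leaf y i == hub x) = false.
Proof. by rewrite eq_sym hub_leaf. Qed.

Lemma arms_linked x i j : i != j ->
  linked (arm_len (st x) i + arm_len (st x) j) (hub x) (tip (st x) i) (tip (st x) j).
Proof.
move=> nij; have [sA lA dA _ _] := stP x.
apply: linked_sub (linked_cat (linked_rev (lA i)) (lA j) _).
  by rewrite subUset !sA.
move=> v w vi wj evw; have : v \in arm (st x) i :&: arm (st x) j.
  by rewrite inE vi evw.
by rewrite dA // => /set1P.
Qed.

(** This is [saturated_series] with ends [hub x] and [hub z]: the five blocks in between are crossed
    either directly, from leaf to leaf, or via two arms of star [y]. *)
Lemma star_route_add g x y z i j j' k r r1 r2 :
  gadget_in P g -> [disjoint gset g & R] -> saturated (gset g :|: R) g ->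
  x != y -> y != z -> x != z -> j != j' ->
  linked r (leaf x i :|: leaf z k) (foot (st x) i) (foot (st z) k) ->
  linked r1 (leaf x i :|: leaf y j) (foot (st x) i) (foot (st y) j) ->
  linked r2 (leaf y j' :|: leaf z k) (foot (st y) j') (foot (st z) k) ->
  stab (glengths g)
    (r%:R - (r1 + r2 + (arm_len (st y) j + arm_len (st y) j').+2)%:R)%R.
Proof.
move=> gP dgR satg nxy nyz nxz njj lr l1 l2.
have [_ _ _ tfx _] := stP x; have [_ _ _ tfy _] := stP y; have [_ _ _ tfz _] := stP z.
pose L := [set leaf x i; leaf y j; hub y; leaf y j'; leaf z k].
have eL : cover L = leaf x i :|: leaf y j :|: hub y :|: leaf y j' :|: leaf z k.
  by rewrite /L !cover_setU !cover1.
have cL : #|L| <= 5 by do 4!apply: leq_card_setU1; rewrite cards1.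
have dXY X Y : X \in R -> Y \in R -> X != Y -> [disjoint X & Y].
  by move=> XR YR; apply: block_disjoint; apply: (subsetP sRP).
have XI : hub x \notin L by rewrite !inE !hub_leaf hub_eq (negbTE nxy).
have ZI : hub z \notin L.
  by rewrite !inE !hub_leaf hub_eq eq_sym (negbTE nyz).
apply: (saturated_series sRP gP dgR satg _ cL (hubR x) (hubR z) XI ZI
         (s := foot (st x) i) (t := foot (st z) k)) => //.
- by rewrite !subUset !sub1set !leafR hubR.
- by rewrite hub_eq.
- apply/touchesP; exists (tip (st x) i); last by rewrite adj_sym.
  have [sA lA _ _ _] := stP x; exact: (subsetP (sA i)) (linked_end (lA i)).
- apply/touchesP; exists (tip (st z) k); last by rewrite adj_sym.
  have [sA lA _ _ _] := stP z; exact: (subsetP (sA k)) (linked_end (lA k)).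
- apply: linked_sub lr; rewrite eL subUset subsetUr andbT.
  by rewrite -!setUA subsetUl.
have ft : foot (st y) j -- tip (st y) j by rewrite adj_sym.
have := linked_jump (linked_jump l1 ft (arms_linked y njj) _) (tfy j') l2 _.
have -> : r1 + (arm_len (st y) j + arm_len (st y) j').+1 + r2.+1 =
          r1 + r2 + (arm_len (st y) j + arm_len (st y) j').+2.
  by rewrite !addnS !addSn addnAC.
rewrite eL -!setUA; apply.
- by rewrite disjoint_setUl !dXY ?leaf_hub.
rewrite !disjoint_setUl ![[disjoint _ & leaf _ _ :|: _]]disjoint_sym !disjoint_setUl.
have neqs : ((z == y) = false) * ((z == x) = false) * ((y == x) = false)
            * ((j' == j) = false).
  by do !split; apply/negbTE; rewrite eq_sym.
by rewrite !dXY ?leaf_hub ?leaf_eq ?neqs ?andbF.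
Qed.

(** Stated as an implication so that [xchoose] applies to every pair; the number chosen has a
    meaning only for distinct stars. *)
Lemma ex_route x i y j : exists r, (x != y) ==>
  linked r (leaf x i :|: leaf y j) (foot (st x) i) (foot (st y) j).
Proof.
have [//|nxy] := eqVneq x y; first by exists 0.
have [_ _ _ _ fx] := stP x; have [_ _ _ _ fy] := stP y.
have PR := subsetP sRP.
have nxy' : leaf x i != leaf y j by rewrite leaf_eq (negbTE nxy).
by have [r] := bridge (PR _ (leafR x i)) (PR _ (leafR y j)) nxy' (fx i) (fy j); exists r.
Qed.

(* Modulo the stabilizers, the choice made by xchoose does not matter. *)
Definition route x i y j : 'Z_q :=
  (xchoose (ex_route x i y j) + arm_len (st x) i + arm_len (st y) j).+2%:R%R.

Section Stable.
Hypotheses (N_ge3 : 3 <= N).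
Variables (I : finType) (g : I -> gadget).
Hypothesis gP : forall e,
  [/\ gadget_in P (g e), [disjoint gset (g e) & R] & saturated (gset (g e) :|: R) (g e)].

(** The stabilizers of all gadgets are intersected because a single class of stars must serve every
    edge of [H]. *)
Definition stable (c : 'Z_q) := [forall e, stab (glengths (g e)) c].

Lemma stable0 : stable 0%R.
Proof. by apply/forallP=> e; apply: stab0. Qed.

Lemma stableB c d : stable c -> stable d -> stable (c - d)%R.
Proof. by move=> /forallP cK /forallP dK; apply/forallP=> e; apply: stabB. Qed.

Lemma route_add x y z i j j' k : x != y -> y != z -> x != z -> j != j' ->
  stable (route x i z k - (route x i y j + route y j' z k))%R.
Proof.
move=> nxy nyz nxz njj; apply/forallP=> e; have [ge dge sate] := gP e.
have := star_route_add ge dge sate nxy nyz nxz njj (implyP (xchooseP (ex_route x i z k)) nxz)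
  (implyP (xchooseP (ex_route x i y j)) nxy) (implyP (xchooseP (ex_route y j' z k)) nyz).
by rewrite (route_lengths _ _ _ _ _ _ (arm_len (st x) i) (arm_len (st z) k)).
Qed.

(** The reversed route is another route from [x] to [y]; both are compared with the same route via a
    third star [z]. *)
Lemma route_sym x y i j : x != y -> stable (route x i y j - route y j x i)%R.
Proof.
move=> nxy; have nyx : y != x by rewrite eq_sym.
have [z nxz nzy] := third N_ge3 x y; rewrite eq_sym in nzy.
pose lk x i y j nxy := implyP (xchooseP (ex_route x i y j)) nxy.
have l := lk x i y j nxy.
have l' : linked (xchoose (ex_route y j x i)) (leaf x i :|: leaf y j)
    (foot (st x) i) (foot (st y) j).
  by rewrite [_ :|: leaf y j]setUC; apply: linked_rev; apply: lk.
apply/forallP=> e; have [ge dge sate] := gP e.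
have n02 : (ord0 : 'I_3) != ord_max by [].
have sr r (lr : linked r (leaf x i :|: leaf y j) (foot (st x) i) (foot (st y) j)) :=
  star_route_add ge dge sate nxz nzy nxy n02 lr (lk x i z ord0 nxz) (lk z ord_max y j nzy).
have := stabB (sr _ l) (sr _ l').
rewrite opprB addrA subrK /route; set r := xchoose _; set r' := xchoose _.
by rewrite -(addnA r') (addnC (arm_len _ _)) addnA -!(addn2 (_ + _)) -!addnA !natrD
  opprD addrACA subrr addr0.
Qed.

Lemma stable_stars : exists C : {set 'I_N}, N <= 2 * #|C| /\
  {in C &, forall x y, x != y -> forall i j, stable (route x i y j)}.
Proof.
apply: two_classes => //; [exact: stable0|exact: stableB| |].
  by move=> x y z i j j' k; apply: route_add.
by move=> x y i j; apply: route_sym.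
Qed.

(** Only one arm of each star is included, not the whole hub, so that zones using different arms of
    a star can share its center and nothing else there. *)
Definition zone x i Q y j : {set G} :=
  arm (st x) i :|: leaf x i :|: cover Q :|: leaf y j :|: arm (st y) j.

Lemma zone_linked e x i y j : x != y -> stable (route x i y j) ->
  exists2 n, (n%:R = 0 :> 'Z_q)%R &
    linked n (zone x i (gset (g e)) y j) (center (st x)) (center (st y)).
Proof.
move=> nxy /forallP/(_ e) stxy; have [ge dge sate] := gP e.
have [i' _ nii] := third (isT : 3 <= 3) i i; have [j' _ njj] := third (isT : 3 <= 3) j j.
have [sx lx _ tfx fx] := stP x; have [sy ly _ tfy fy] := stP y.
have nyx : y != x by rewrite eq_sym.
have touch z k : touches (tip (st z) k) (leaf z k).
  by have [_ _ _ tf f] := stP z; apply/touchesP; exists (foot (st z) k).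
have PR := subsetP sRP; have ni'i : i' != i by rewrite eq_sym.
have ft : foot (st y) j -- tip (st y) j by rewrite adj_sym.
(* Second leaves at [x] and [y] serve as ends of the enlarged gadget. The shift is minus the route
   length, so that the path between centers gets length 0. *)
have [||n ln en] := saturated_parallel (A := hub x) (A' := leaf x i) (I := leaf x i')
  (B := hub y) (B' := leaf y j) (J := leaf y j') sRP ge dge sate _ _
  (arms_linked x ni'i) (tfx i) (fx i) (touch x i') (arms_linked y njj) ft (fy j) (touch y j')
  (implyP (xchooseP (ex_route x i y j)) nxy) (stabB (stab0 _) stxy).
- rewrite /= !inE !hub_leaf !leaf_hub !leaf_eq hub_eq (negbTE nxy) (negbTE nii).
  by rewrite (negbTE njj) !andbF /=.
- by apply/allP; rewrite /= !hubR !leafR.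
have dW z k X : X \in R -> X != hub z -> [disjoint arm (st z) k & X].
  move=> XR Xz; have [sz _ _ _ _] := stP z.
  by apply: disjointWl (sz k) _; apply: block_disjoint; rewrite ?PR // eq_sym.
have dg z k : [disjoint arm (st z) k & cover (gset (g e))].
  have [sz _ _ _ _] := stP z; apply: disjointWl (sz k) _; rewrite disjoint_sym.
  have := R_cover_disjoint sRP ge dge (Q := [set hub z]).
  by rewrite cover1 sub1set; apply.
have := linked_jump (linked_jump (lx i) (tfx i) ln _) ft (linked_rev (ly j)) _.
rewrite !setUA => l; exists (arm_len (st x) i + n.+1 + (arm_len (st y) j).+1); last first.
  apply: l.
    rewrite disjoint_sym !disjoint_setUl !(disjoint_sym _ (arm _ _)) dg.
    by rewrite !dW ?leaf_hub.
  rewrite !disjoint_setUl !(disjoint_sym _ (arm (st y) j)) dg.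
  rewrite !(dW y j (leaf _ _)) ?leaf_hub // disjoint_sym !andbT; apply: disjointW (sx i) (sy j) _.
  by apply: block_disjoint; rewrite ?PR // hub_eq.
exact: reroute_lengths en.
Qed.

End Stable.
End Stars.

End Blocks.

(** * Subdivisions from zones *)

Lemma infix_map (T U : eqType) (f : T -> U) s1 s2 : injective f ->
  infix (map f s1) (map f s2) = infix s1 s2.
Proof.
move=> injf; apply/infixP/infixP => [[p [s e]]|[p [s ->]]]; last first.
  by exists (map f p), (map f s); rewrite !map_cat.
exists (take (size p) s2), (drop (size s1) (drop (size p) s2)).
suff {1}<- : take (size s1) (drop (size p) s2) = s1 by rewrite !cat_take_drop.
by apply: (inj_map injf); rewrite map_take map_drop e drop_size_cat // take_size_cat ?size_map.
Qed.

Lemma path_of_infix (T : eqType) (e : rel T) a p :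
  (forall u v, infix [:: u; v] (a :: p) -> e u v) -> path e a p.
Proof.
elim: p a => // b p IHp a he; apply/andP; split.
  by apply: he; apply: (prefix_infix [:: a; b] p).
apply: IHp => u v /infixP[s [s' e_bp]]; apply: he.
by apply/infixP; exists (a :: s), s'; rewrite e_bp.
Qed.

Section Assembly.
Variables (H G : sgraph) (q : nat) (br : H -> G) (Z : H -> H -> {set G}).
Hypothesis br_inj : injective br.
Hypothesis Zpath : forall x y, x -- y ->
  exists2 n, q %| n & linked n (Z x y) (br x) (br y).
Hypothesis Zsym : forall x y, Z x y = Z y x.
Hypothesis Zbr : forall x y z, x -- y -> br z \in Z x y -> z = x \/ z = y.
Hypothesis Zmeet : forall x y u v w, x -- y -> u -- v ->
  [set x; y] != [set u; v] -> w \in Z x y -> w \in Z u v -> exists z, w = br z.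

(** [s] lists the inner vertices only, so the path has [(size s).+1] edges. *)
Definition strand (x y : H) (s : seq G) :=
  [/\ path (@adj G) (br x) (rcons s (br y)), uniq (br x :: rcons s (br y)),
      {subset s <= Z x y} & q %| (size s).+1].

Lemma strand_exists x y : x -- y -> exists s, strand x y s.
Proof.
move=> xy; have [n qn /linkedP[s0]] := Zpath xy.
case/and5P=> ps /eqP ls us /allP Zs /eqP sn; case: (lastP s0) ps ls us Zs sn.
  by move=> _ /br_inj exy; rewrite exy adj_irrefl in xy.
move=> s v; rewrite last_rcons => + ev; rewrite ev => ps us Zs sn; exists s; split=> //.
  by move=> w ws; apply: Zs; rewrite inE mem_rcons inE ws !orbT.
by rewrite -(size_rcons s (br y)) sn.
Qed.

Lemma strand_rev x y s : strand x y s -> strand y x (rev s).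
Proof.
case=> ps us Zs qs; have e : br y :: rcons (rev s) (br x) = rev (br x :: rcons s (br y)).
  by rewrite rev_cons rev_rcons.
split.
- have := rev_path (@adj G) (br x) (rcons s (br y)).
  rewrite last_rcons belast_rcons rev_cons => ->.
  by rewrite (eq_path (e' := @adj G)) // => u v; rewrite adj_sym.
- by rewrite e rev_uniq.
- by move=> v; rewrite mem_rev Zsym => /Zs.
- by rewrite size_rev.
Qed.

(** One strand is chosen per ordered pair; [enum_rank] decides which orientation of an edge is kept,
    and the other one is its reversal. *)
Lemma strands : exists inn : H -> H -> seq G,
  (forall x y, x -- y -> strand x y (inn x y)) /\
  (forall x y, x -- y -> inn y x = rev (inn x y)).
Proof.
have ex (e : H * H) : exists s, e.1 -- e.2 -> strand e.1 e.2 s.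
  have [/strand_exists[s es]|_] := boolP (e.1 -- e.2); last by exists [::].
  by exists s.
have [s sP] := fin_all_exists ex.
exists (fun x y => if enum_rank x < enum_rank y then s (x, y) else rev (s (y, x))).
split=> [x y xy|x y xy].
  case: ifP => _; first exact: sP.
  by apply: strand_rev; apply: sP; rewrite /= adj_sym.
case: ltngtP => [_|_|]; rewrite ?revK //.
by move=> /val_inj /enum_rank_inj exy; rewrite exy adj_irrefl in xy.
Qed.

Lemma contains_of_zones : contains_divisible_subdivision q H G.
Proof.
have [inn [innP inn_rev]] := strands.
pose full x y := br x :: rcons (inn x y) (br y).
pose V v := [exists x, v == br x] || [exists x, exists y, (x -- y) && (v \in inn x y)].
have Vbr x : V (br x) by apply/orP; left; apply/existsP; exists x.
have Vinn x y v : x -- y -> v \in inn x y -> V v.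
  move=> xy vi; apply/orP; right; apply/existsP; exists x; apply/existsP.
  by exists y; rewrite xy.
pose S := {v : G | V v}.
(* Only consecutive vertices of a strand are adjacent; the induced subgraph of [G] could violate
   [edge_cover]. *)
pose aS (u v : S) := [exists x, exists y, (x -- y) && infix [:: val u; val v] (full x y)].
have aSP u v : reflect (exists x y, x -- y /\ infix [:: val u; val v] (full x y)) (aS u v).
  apply: (iffP existsP) => [[x /existsP[y /andP[]]]|[x [y [xy uv]]]].
    by exists x, y.
  by exists x; apply/existsP; exists y; rewrite xy.
have full_rev x y : x -- y -> full y x = rev (full x y).
  by move=> xy; rewrite /full inn_rev // rev_cons rev_rcons.
have aS_sub u v : aS u v -> val u -- val v.
  case/aSP=> x [y [xy uv]]; have [px _ _ _] := innP x y xy.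
  by have /= := infix_sorted uv px; rewrite andbT.
have aS_sym : symmetric aS.
  suff sym u v : aS u v -> aS v u by move=> u v; apply/idP/idP; apply: sym.
  case/aSP=> x [y [xy uv]]; apply/aSP; exists y, x; split; first by rewrite adj_sym.
  by rewrite full_rev // -infix_rev revK.
have aS_irr : irreflexive aS.
  by move=> u; case E: (aS u u) => //; have := aS_sub _ _ E; rewrite adj_irrefl.
pose SG : sgraph := SGraph aS_sym aS_irr.
have lift (s : seq G) : {subset s <= V} -> exists t : seq S, map val t = s.
  elim: s => [|v s IHs] Vs; first by exists [::].
  have [|t <-] := IHs; first by move=> w ws; apply: Vs; rewrite inE ws orbT.
  have Vv : V v by apply: Vs; rewrite inE eqxx.
  by exists ((Sub v Vv : S) :: t).
have ex (e : H * H) : exists t : seq S, e.1 -- e.2 -> map val t = inn e.1 e.2.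
  have [exy|_] := boolP (e.1 -- e.2); last by exists [::].
  by have [t et] := lift (inn e.1 e.2) (fun v => Vinn _ _ v exy); exists t.
have [t tP] := fin_all_exists ex.
pose brS x : SG := Sub (br x) (Vbr x).
pose innS x y : seq SG := t (x, y).
have innE x y : x -- y -> map val (innS x y) = inn x y by move=> xy; apply: tP.
have fullE x y : x -- y -> map val (brS x :: rcons (innS x y) (brS y)) = full x y.
  by move=> xy; rewrite /= map_rcons innE.
have mem_innS x y v : x -- y -> (v \in innS x y) = (val v \in inn x y).
  by move=> xy; rewrite -innE // mem_map //; apply: val_inj.
have brS_inj : injective brS by move=> x y [/br_inj].
have S_path x y : x -- y -> path (@adj SG) (brS x) (rcons (innS x y) (brS y)).
  move=> xy; apply: path_of_infix => u v uv; apply/aSP; exists x, y; split=> //.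
  by rewrite -fullE // -[[:: _; _]]/(map val [:: u; v]) infix_map //; apply: val_inj.
have S_uniq x y : x -- y -> uniq (innS x y).
  move=> xy; rewrite -(map_inj_uniq val_inj) innE //.
  by have [_ /= /andP[_]] := innP x y xy; rewrite rcons_uniq => /andP[].
have S_rev x y : x -- y -> innS y x = rev (innS x y).
  move=> xy; apply: (inj_map val_inj); rewrite map_rev (innE x y xy) -inn_rev //.
  by rewrite innE // adj_sym.
have S_branch x y z : x -- y -> brS z \notin innS x y.
  move=> xy; rewrite mem_innS //=; have [_ us Zs _] := innP x y xy.
  apply/negP=> zi; move: us; rewrite /= mem_rcons rcons_uniq inE negb_or.
  by have [ez|ez] := Zbr xy (Zs _ zi); rewrite ez in zi; rewrite zi ?andbF.
have S_disj x y u v : x -- y -> u -- v -> [set x; y] != [set u; v] ->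
    [disjoint innS x y & innS u v].
  move=> xy uv nxu; apply/pred0P=> w /=; apply/negP=> /andP[wx wu].
  have [_ _ Zx _] := innP x y xy; have [_ _ Zu _] := innP u v uv.
  have := wx; rewrite mem_innS // => wx'; have := wu; rewrite mem_innS // => wu'.
  have [z ez] := Zmeet xy uv nxu (Zx _ wx') (Zu _ wu').
  have ew : w = brS z by apply: val_inj.
  by have := S_branch x y z xy; rewrite -ew wx.
have S_vcover (s : SG) :
    (exists x, s = brS x) \/ (exists x y, x -- y /\ s \in innS x y).
  case/orP: (valP s) => [/existsP[x /eqP es]|/existsP[x /existsP[y /andP[xy sx]]]].
    by left; exists x; apply: val_inj.
  by right; exists x, y; rewrite mem_innS.
have S_ecover (s u : SG) : s -- u ->
    exists x y, x -- y /\ infix [:: s; u] (brS x :: rcons (innS x y) (brS y)).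
  case/aSP=> x [y [xy su]]; exists x, y; split=> //.
  by rewrite -(infix_map _ _ val_inj) fullE.
exists SG, (Subdivision brS_inj S_path S_uniq S_rev S_branch S_disj S_vcover S_ecover).
split; last by exists val; split; [apply: val_inj|apply: aS_sub].
move=> x y xy; rewrite /path_length /sub_path /= size_rcons.
by have [_ _ _] := innP x y xy; rewrite -innE // size_map.
Qed.

End Assembly.

(** * The two bounds *)

Lemma mem_edges (H : sgraph) (x y : H) : x -- y -> [set x; y] \in edges H.
Proof. by move=> xy; apply/imset2P; exists x y; rewrite ?inE. Qed.

Lemma edgesP (H : sgraph) (E : {set H}) : E \in edges H ->
  exists p : H * H, p.1 -- p.2 /\ E = [set p.1; p.2].
Proof. by case/imset2P=> x y _; rewrite inE => /andP[_ xy] ->; exists (x, y). Qed.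

Lemma complete_sym f : symmetric (fun x y : 'I_f => x != y).
Proof. by move=> x y; rewrite eq_sym. Qed.

Lemma complete_irr f : irreflexive (fun x y : 'I_f => x != y).
Proof. by move=> x; rewrite eqxx. Qed.

Definition complete f : sgraph := SGraph (@complete_sym f) (@complete_irr f).

Lemma complete_K_minor f : K_minor f (complete f).
Proof.
exists [set [set x] | x in [set: complete f]]; split.
- apply/and3P; split.
  + rewrite eqEsubset subsetT; apply/subsetP=> x _; apply/bigcupP.
    by exists [set x]; rewrite ?inE // imset_f ?inE.
  + apply/trivIsetP=> _ _ /imsetP[x _ ->] /imsetP[y _ ->] nxy.
    by rewrite disjoints1 inE; apply: contraNneq nxy => ->.
  + by apply/imsetP=> [[x _ /setP/(_ x)]]; rewrite !inE eqxx.
- by rewrite card_imset ?cardsT ?card_ord //; apply: set1_inj.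
- move=> _ /imsetP[x _ ->] y z /set1P -> /set1P ->; exact: connect0.
- move=> _ _ /imsetP[x _ ->] /imsetP[y _ ->] nxy; exists x, y.
  by split; rewrite ?inE //; apply: contraNneq nxy => ->.
Qed.

(** A subdivision path has positive length divisible by [q], hence at least [q - 1] inner vertices.
    [F] injects that many per edge, together with the branch vertices, into [S]. *)
Lemma subdivision_card q (H S : sgraph) (D : subdivision H S) :
  divisible q D -> #|edges H| * (q - 1) + #|H| <= #|S|.
Proof.
move=> divD; have [e eP] := fin_all_exists (fun E : {E | E \in edges H} => edgesP (valP E)).
pose inn E := inner D (e E).1 (e E).2.
have le_inn E : q - 1 <= size (inn E).
  have [ee _] := eP E; have := divD _ _ ee; rewrite /path_length /= size_rcons => /dvdn_leq.
  by rewrite -/(inn E) => /(_ isT); lia.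
pose F (z : {E | E \in edges H} * 'I_(q - 1) + H) : S :=
  match z with
  | inl Ei => nth (branch D (e Ei.1).1) (inn Ei.1) Ei.2
  | inr x => branch D x
  end.
have memF E (i : 'I_(q - 1)) : F (inl (E, i)) \in inn E.
  by apply: mem_nth; apply: leq_trans (le_inn E).
have innF E i x : F (inl (E, i)) = branch D x -> False.
  move=> eF; have [ee _] := eP E; have /negP[] := inner_branch D x ee.
  by rewrite -eF; apply: memF.
have injF : injective F.
  move=> [[E i]|x] [[E' i']|x'].
  - have [EE'|nEE'] := eqVneq E E'.
      rewrite -{}EE' => /eqP; have [ee _] := eP E.
      rewrite nth_uniq ?(inner_uniq D ee) ?(leq_trans _ (le_inn E)) // => /eqP ii.
      by congr (inl (_, _)); apply: val_inj.
    move=> eF; have [ee eE] := eP E; have [ee' eE'] := eP E'.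
    have nE : [set (e E).1; (e E).2] != [set (e E').1; (e E').2] by rewrite -eE -eE'.
    have := inner_disjoint D ee ee' nE.
    by move/disjointFr=> /(_ _ (memF E i)); rewrite eF memF.
  - by move=> /innF.
  - by move=> /esym /innF.
  - by move=> /branch_inj ->.
by have := leq_card F injF; rewrite card_sum card_prod card_sig card_ord.
Qed.

Lemma forces_lower H q f : forces H q f -> #|edges H| * (q - 1) + #|H| <= f.
Proof.
move=> /(_ _ (complete_K_minor f))[S [D [divD [h [injh _]]]]].
by apply: leq_trans (subdivision_card divD) _; have := leq_card h injh; rewrite card_ord.
Qed.

(** Assigns the edges at a vertex to distinct arms of its star, by the rank of the neighbour. *)
Lemma leg_exists (H : sgraph) : max_degree H <= 3 ->
  exists leg : H -> H -> 'I_3,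
    forall x y z, x -- y -> x -- z -> leg x y = leg x z -> y = z.
Proof.
move=> H3; exists (fun x y => inord (index y (enum [set z | x -- z]))).
move=> x y z xy xz /(congr1 val) /=.
have deg3 : #|[set z | x -- z]| <= 3.
  by apply: leq_trans H3; apply: (leq_bigmax_cond (F := @degree H)).
have [yi zi] : y \in enum [set z | x -- z] /\ z \in enum [set z | x -- z].
  by rewrite !mem_enum !inE.
have lt v : v \in enum [set z | x -- z] -> index v (enum [set z | x -- z]) < 3.
  by rewrite -index_mem -cardE => /leq_trans; apply.
rewrite !inordK ?lt // => eyz.
by rewrite -(nth_index x yi) eyz nth_index.
Qed.

Section UpperBound.
Variables (H : sgraph) (q : nat).
Hypotheses (H3 : max_degree H <= 3) (q_gt1 : 1 < q).

(** The gadgets consume at most 7mq blocks; the remaining 8n + 12 make 2n + 3 stars of four blocks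
    each. *)
Lemma forces_upper : forces H q (7 * #|edges H| * q + 8 * #|H| + 12).
Proof.
move=> G [P [partP cardP connP edgeP]].
have /and3P[_ trivP _] := partP.
(* At least half of the [N] stars are kept, enough for the vertices of [H]; the extra three ensure
   [3 <= N]. *)
pose m := #|edges H|; pose N := (2 * #|H|).+3.
have [|g [R [sRP RN gP dg]]] := exists_gadgets trivP connP edgeP q_gt1 (k := m) (subxx P).
  by rewrite cardP -/m; lia.
have [|hub [leaf [hubR leafR hub_eq leaf_eq hub_leaf]]] := @exists_blocks G R N.
  by move: RN; rewrite cardP -/m /N; lia.
have PR := subsetP sRP.
have ex x : exists S, star_in (hub x) (leaf x) S.
  apply: (exists_star connP edgeP); first exact: PR.
    by move=> i; apply: PR.
  by move=> i; rewrite hub_leaf.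
have [st stP] := fin_all_exists ex.
have gPm (e : 'I_m) : [/\ gadget_in P (g e), [disjoint gset (g e) & R]
    & saturated q (gset (g e) :|: R) (g e)] by apply: gP.
have [C [NC stC]] := stable_stars trivP connP edgeP q_gt1 sRP hubR leafR hub_eq leaf_eq
  hub_leaf stP (isT : 3 <= N) gPm.
have [phi [phi_inj phiC]] : exists phi : H -> 'I_N, injective phi /\ forall x, phi x \in C.
  have le (x : H) : enum_rank x < size (enum C).
    rewrite -cardE; apply: leq_trans (ltn_ord _) _.
    by rewrite -(leq_pmul2l (isT : 0 < 2)); do 3!apply: ltnW; apply: NC.
  exists (fun x => nth ord0 (enum C) (enum_rank x)); split=> [x y /eqP|x].
    by rewrite nth_uniq ?le ?enum_uniq // => /eqP/val_inj/enum_rank_inj.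
  by rewrite -mem_enum mem_nth.
have [leg legP] := leg_exists H3.
(* Indexing by the unordered pair gives both orientations of an edge the same gadget. *)
pose idx (x y : H) := index [set x; y] (enum (edges H)).
have idx_lt x y : x -- y -> idx x y < m.
  by move=> xy; rewrite /m cardE index_mem mem_enum mem_edges.
pose Q x y := gset (g (idx x y)).
pose Z x y := zone leaf st (phi x) (leg x y) (Q x y) (phi y) (leg y x).
have Qsym x y : Q x y = Q y x by rewrite /Q /idx setUC.
have armS x y : x -- y -> arm (st (phi x)) (leg x y) \subset hub (phi x).
  by have [sA _ _ _ _] := stP (phi x).
have QP x y : x -- y -> Q x y \subset P.
  by move=> /idx_lt /gP[/andP[]].
have meet (v : G) (X Y : {set G}) : v \in X -> v \in Y -> X \in P -> Y \in P -> X = Y.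
  move=> vX vY XP YP; have [//|nXY] := eqVneq X Y.
  by have := block_disjoint trivP XP YP nXY => /disjointFr/(_ vX); rewrite vY.
have RQ (v : G) x y (X : {set G}) : x -- y -> X \in R -> v \in X -> v \in cover (Q x y) -> False.
  move=> xy XR vX /bigcupP[Y YQ vY]; have [_ dQ _] := gP _ (idx_lt _ _ xy).
  have eXY := meet v X Y vX vY (PR X XR) (subsetP (QP x y xy) Y YQ).
  by have := disjointFr dQ YQ; rewrite -eXY XR.
(* Orienting the edge suitably leaves three positions for a vertex of a zone instead of five. *)
have ZP (v : G) x y : x -- y -> v \in Z x y -> exists a b, [/\ a -- b, [set a; b] = [set x; y]
    & [\/ v \in arm (st (phi a)) (leg a b), v \in leaf (phi a) (leg a b) | v \in cover (Q a b)]].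
  move=> xy; have yx : y -- x by rewrite adj_sym.
  rewrite /Z /zone !inE -!orbA => /or4P[v1|v1|v1|/orP[v1|v1]].
  - by exists x, y; split=> //; apply: Or31.
  - by exists x, y; split=> //; apply: Or32.
  - by exists x, y; split=> //; apply: Or33.
  - by exists y, x; split=> //; [rewrite setUC|apply: Or32].
  - by exists y, x; split=> //; [rewrite setUC|apply: Or31].
have center_hub z : center (st (phi z)) \in hub (phi z).
  by have [sA lA _ _ _] := stP (phi z); apply: (subsetP (sA ord0)) (linked_start (lA ord0)).
apply: (contains_of_zones (br := fun x => center (st (phi x))) (Z := Z)).
- move=> x y exy; apply: phi_inj; apply/eqP; rewrite -hub_eq; apply/eqP.
  by apply: (meet (center (st (phi x)))); rewrite ?PR // exy.
- move=> x y xy; have nxy : phi x != phi y.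
    by apply: contraTneq xy => /phi_inj ->; rewrite adj_irrefl.
  have [n n0 ln] := zone_linked hubR hub_eq hub_leaf gPm (Ordinal (idx_lt x y xy)) nxy
    (stC _ _ (phiC x) (phiC y) nxy (leg x y) (leg y x)).
  exists n => //; rewrite /dvdn; apply/eqP.
  by rewrite -(val_Zp_nat q_gt1) n0.
- move=> x y; rewrite /Z /zone Qsym; apply/setP=> v; rewrite !inE.
  by do 5!case: (_ \in _).
- move=> x y z xy /(ZP _ _ _ xy)[a [b [ab eab vab]]].
  have az : a = z.
    case: vab => [va|va|va]; last by case: (RQ _ _ _ _ ab (hubR (phi z)) (center_hub z) va).
      apply: phi_inj; apply/eqP; rewrite -hub_eq; apply/eqP.
      by apply: (meet (center (st (phi z)))); rewrite ?PR //; apply: (subsetP (armS a b ab)).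
    have := meet _ _ _ va (center_hub z) (PR _ (leafR _ _)) (PR _ (hubR _)).
    by move/eqP; rewrite leaf_hub.
  by have := set21 a b; rewrite eab az => /set2P.
- move=> x y u v w xy uv nxu /(ZP _ _ _ xy)[a [b [ab eab wab]]]
    /(ZP _ _ _ uv)[c [d [cd ecd wcd]]].
  have {nxu} nE : [set a; b] != [set c; d] by rewrite eab ecd.
  (* Two arms meet only at a common center. All other cases are absurd: a common leaf would give the
     same edge, distinct edges have disjoint gadgets, and mixed positions lie in different
     blocks. *)
  case: wab wcd => [wa|wa|wa] [wc|wc|wc].
  + exists a; have eac : a = c.
      apply: phi_inj; apply/eqP; rewrite -hub_eq; apply/eqP.
      by apply: (meet w); rewrite ?PR ?(subsetP (armS _ _ ab)) ?(subsetP (armS _ _ cd)).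
    have nl : leg a b != leg a d.
      apply: contraNneq nE => el; rewrite -eac in cd *.
      by rewrite (legP a b d ab cd el).
    have [_ _ dA _ _] := stP (phi a).
    have : w \in arm (st (phi a)) (leg a b) :&: arm (st (phi a)) (leg a d).
      by rewrite inE wa eac.
    by rewrite dA // => /set1P.
  + have wa' := subsetP (armS _ _ ab) _ wa.
    have := meet _ _ _ wa' wc (PR _ (hubR _)) (PR _ (leafR _ _)).
    by move/eqP; rewrite hub_leaf.
  + by case: (RQ _ _ _ _ cd (hubR (phi a)) (subsetP (armS _ _ ab) _ wa) wc).
  + have wc' := subsetP (armS _ _ cd) _ wc.
    have := meet _ _ _ wc' wa (PR _ (hubR _)) (PR _ (leafR _ _)).
    by move/eqP; rewrite hub_leaf.
  + have := meet _ _ _ wa wc (PR _ (leafR _ _)) (PR _ (leafR _ _)).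
    move/eqP; rewrite leaf_eq => /andP[/eqP/phi_inj eac /eqP el].
    rewrite -eac in cd el nE; by rewrite (legP a b d ab cd el) eqxx in nE.
  + by case: (RQ _ _ _ _ cd (leafR (phi a) (leg a b)) wa wc).
  + by case: (RQ _ _ _ _ ab (hubR (phi c)) (subsetP (armS _ _ cd) _ wc) wa).
  + by case: (RQ _ _ _ _ ab (leafR (phi c) (leg c d)) wc wa).
  + have nidx : idx a b != idx c d.
      apply: contraNneq nE => ei; apply/eqP.
      have := nth_index set0 (_ : [set a; b] \in enum (edges H)); rewrite -/(idx a b) ei.
      by move=> <-; rewrite ?nth_index ?mem_enum ?mem_edges.
    have dQ : [disjoint Q a b & Q c d].
      have lab := idx_lt _ _ ab; have lcd := idx_lt _ _ cd.
      move: nidx; rewrite neq_ltn => /orP[lt|lt]; first exact: dg lt lcd.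
      by rewrite disjoint_sym; apply: dg lt lab.
    have := cover_disjoint trivP (QP _ _ ab) (QP _ _ cd) dQ.
    by move/disjointFr/(_ wa); rewrite wc.
Qed.

End UpperBound.

(** Classical, because [forces] quantifies over all graphs and comes with no decision procedure. *)
Lemma least_nat (A : nat -> Prop) n : A n ->
  exists2 k, A k & forall l, A l -> k <= l.
Proof.
elim/ltn_ind: n => n IHn An.
have [[k ltkn Ak]|noA] := classic (exists2 k, k < n & A k); first exact: IHn Ak.
exists n => // l Al; rewrite leqNgt; apply/negP=> ltln.
by apply: noA; exists l.
Qed.

Theorem theorem1p2 :
  (forall (H : sgraph) (q : nat), max_degree H <= 3 -> 2 <= q ->
     exists f : nat, is_f H q f /\
       #|edges H| * (q - 1) + #|H| <= f
         <= 7 * #|edges H| * q + 8 * #|H| + 14 * q)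
  /\
  (exists c C : rat, (0 < c)%R /\ (0 < C)%R /\
     forall (H : sgraph) (q f : nat),
       max_degree H <= 3 -> 2 <= q -> 0 < #|H| -> is_f H q f ->
       (c * (#|edges H| * q + #|H|)%N%:R <= f%:R
          <= C * (#|edges H| * q + #|H|)%N%:R)%R).
Proof.
have upper H q : max_degree H <= 3 -> 2 <= q ->
    0 < 7 * #|edges H| * q + 8 * #|H| + 12 /\
    forces H q (7 * #|edges H| * q + 8 * #|H| + 12).
  by move=> H3 q2; split; [rewrite addn_gt0 orbT|apply: forces_upper].
split=> [H q H3 q2|].
  have [f [f0 Ff] minf] := least_nat (A := fun f => 0 < f /\ forces H q f) (upper H q H3 q2).
  exists f; split; first by split=> // k k0 Fk; apply: minf.
  rewrite forces_lower //=; apply: leq_trans (minf _ (upper H q H3 q2)) _.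
  by rewrite leq_add2l; apply: leq_trans (leq_mul (leqnn 14) q2).
(* For 1/2: q <= 2(q - 1) as q >= 2. For 20: 12 <= 12n as n >= 1, so 7mq + 8n + 12 <= 7mq + 20n. *)
exists (2%:R^-1)%R, (20%:R)%R; do 2![split=> //].
move=> H q f H3 q2 H0 [f0 Ff minf].
have lower := forces_lower Ff; have [u0 uF] := upper H q H3 q2.
have {uF} le := minf _ u0 uF; apply/andP; split.
  rewrite mulrC ler_pdivrMr ?ltr0n // -natrM ler_nat; move: lower.
  move: #|edges H| #|H| => m n lo.
  have : m <= m * (q - 1) by apply: leq_pmulr; rewrite subn_gt0.
  by have := mulnBr m q 1; rewrite muln1; lia.
rewrite -natrM ler_nat; move: le H0; move: #|edges H| #|H| => m n le n0.
apply: leq_trans le _; nia.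
Qed.
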